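(* Let $\alpha,\beta\in\{0,1,2,\dots\}$. Passing from $\mathbf g\in G$ to the double coset $K[\alpha]\,\mathbf g\,K[\beta]\in K[\alpha]\backslash G/K[\beta]$ is equivalent to forgetting, on the surface $\Xi(\mathbf g)$, all plus-labels with numbers $>\beta$ and all minus-labels with numbers $>\alpha$. That is, for $\mathbf g,\mathbf g'\in G$ one has $K[\alpha]\,\mathbf g\,K[\beta]=K[\alpha]\,\mathbf g'\,K[\beta]$ if and only if the partially labeled surfaces obtained from $\Xi(\mathbf g)$ and $\Xi(\mathbf g')$ by forgetting these labels are combinatorially equivalent.
   Context: $S_\infty$ is the group of finitely supported permutations of $\mathbb N=\{1,2,\dots\}$, $G=S_\infty\times S_\infty\times S_\infty$ with elements $\mathbf g=(g_{red},g_{yellow},g_{blue})$, $K=\{(h,h,h):h\in S_\infty\}$ is the diagonal subgroup, and $K[\alpha]\subset K$ is the subgroup of those $(h,h,h)$ for which $h$ fixes $1,\dots,\alpha$. Permutations act from the left, $(gh)(k)=g(h(k))$. Construction of $\Xi(\mathbf g)$: take a countable collection of identical oriented triangles, numbered by $\mathbb N$, with sides colored red, yellow, blue clockwise (plus-triangles), and another such collection, numbered by $\mathbb N$, with sides colored red, yellow, blue anticlockwise (minus-triangles). The numbers are called plus-labels and minus-labels respectively. For each color $\nu$ and each $k$, if $g_\nu k=l$, glue the $\nu$-colored side of the $k$-th plus-triangle with the $\nu$-colored side of the $l$-th minus-triangle, compatibly with the orientations. The result is a disjoint union of oriented compact surfaces glued from triangles, with signs on triangles, colors on edges, and labels on triangles.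 Combinatorial equivalence of (partially) labeled surfaces means an orientation-preserving isomorphism of the triangulated surfaces preserving signs, colors of edges, and the remaining labels. *)

(* Defs.v *)
From HB Require Import structures.
From mathcomp Require Import all_boot.
From mathcomp Require Import boolp classical_sets functions cardinality.

Set Implicit Arguments.
Unset Strict Implicit.
Unset Printing Implicit Defensive.

Local Open Scope classical_set_scope.

(* The natural numbers here start at 1. *)
Definition N := {n : nat | 0 < n}.

(** * The groups *)

Record Sinf := MkSinf {
  sfun :> N -> N;
  sinv : N -> N;
  sfunK : cancel sfun sinv;
  sinvK : cancel sinv sfun;
  sfun_supp : finite_set [set k | sfun k <> k]
}.

Lemma SinfP (g h : Sinf) : sfun g =1 sfun h -> g = h.
Proof.
case: g h => [f f' fK f'K sf] [h h' hK h'K sh] /= /funext E.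
move: hK h'K sh; rewrite -{}E => hK h'K sh.
have E' : h' = f' by apply/funext => k; rewrite -{1}(f'K k) hK.
move: hK h'K; rewrite {}E' => hK h'K.
by congr MkSinf; exact: Prop_irrelevance.
Qed.

Lemma id_supp : finite_set [set k : N | idfun k <> k].
Proof. by apply: (sub_finite_set _ (finite_set0 N)) => k. Qed.

Definition Sinf_one : Sinf :=
  @MkSinf idfun idfun (fun=> erefl) (fun=> erefl) id_supp.

Lemma comp_supp (g h : Sinf) :
  finite_set [set k | (sfun g \o sfun h) k <> k].
Proof.
apply: (@sub_finite_set _ _
  ([set k | sfun g k <> k] `|` [set k | sfun h k <> k])); last first.
  by rewrite finite_setU; split; exact: sfun_supp.
move=> k /= ghk; case: (pselect (h k = k)) => [hk|]; last by right.
by left; rewrite hk in ghk.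
Qed.

(* (g h)(k) = g (h k) *)
Definition Sinf_mul (g h : Sinf) : Sinf :=
  @MkSinf (sfun g \o sfun h) (sinv h \o sinv g)
    (can_comp (@sfunK g) (@sfunK h)) (can_comp (@sinvK h) (@sinvK g))
    (comp_supp g h).

Lemma inv_supp (g : Sinf) : finite_set [set k | sinv g k <> k].
Proof.
apply: (sub_finite_set _ (sfun_supp g)) => k /= gk E.
by apply: gk; rewrite -{1}E sfunK.
Qed.

Definition Sinf_inv (g : Sinf) : Sinf :=
  @MkSinf (sinv g) (sfun g) (@sinvK g) (@sfunK g) (inv_supp g).

Lemma Sinf_mulA : associative Sinf_mul.
Proof. by move=> f g h; exact: SinfP. Qed.
Lemma Sinf_mul1 : left_id Sinf_one Sinf_mul.
Proof. by move=> g; exact: SinfP. Qed.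
Lemma Sinf_1mul : right_id Sinf_one Sinf_mul.
Proof. by move=> g; exact: SinfP. Qed.
Lemma Sinf_mulV : left_inverse Sinf_one Sinf_inv Sinf_mul.
Proof. by move=> g; apply: SinfP => k /=; rewrite sfunK. Qed.
Lemma Sinf_Vmul : right_inverse Sinf_one Sinf_inv Sinf_mul.
Proof. by move=> g; apply: SinfP => k /=; rewrite sinvK. Qed.

HB.instance Definition _ := gen_eqMixin Sinf.
HB.instance Definition _ := gen_choiceMixin Sinf.
HB.instance Definition _ :=
  isGroup.Build Sinf Sinf_mulA Sinf_mul1 Sinf_1mul Sinf_mulV Sinf_Vmul.

Inductive color := Red | Yellow | Blue.

Definition G : groupType := (Sinf * Sinf * Sinf)%type.

Definition gcol (g : G) (nu : color) : Sinf :=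
  match nu with Red => g.1.1 | Yellow => g.1.2 | Blue => g.2 end.

Definition diag (h : Sinf) : G := (h, h, h).

Definition K (a : nat) : set G :=
  diag @` [set h : Sinf | forall k : N, val k <= a -> h k = k].

Definition double_coset (a b : nat) (g : G) : set G :=
  [set (x * g * y)%g | x in K a & y in K b].

(** * Labeled triangulated surfaces *)

Inductive linked (D : Type) (cw glue : D -> D) (s : D) : D -> Prop :=
| linked_refl : linked cw glue s s
| linked_cw t : linked cw glue s t -> linked cw glue s (cw t)
| linked_glue t : linked cw glue s t -> linked cw glue s (glue t).

(* A disjoint union of closed oriented surfaces glued from triangles, as a
   combinatorial map. The elements of [side] are the sides of the individual
   triangles, before gluing; [cw] sends a side of a triangle to the next side of
   the same triangle in the clockwise direction, with respect to the orientation
   of the surface; [glue] sends a side to the side it is glued with, the two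
   being identified in the way compatible with the orientations. Thus edges are
   the orbits of [glue] and vertices are the orbits of [cw \o glue].
   [surf_compact] says that each connected component consists of finitely many
   triangles. *)
Record surface := Surface {
  triangle : Type;
  side : Type;
  tri : side -> triangle;
  cw : side -> side;
  glue : side -> side;
  tri_surj : forall t, exists s, tri s = t;
  triP : forall s s', tri s = tri s' <-> [\/ s' = s, s' = cw s | s' = cw (cw s)];
  cw3 : forall s, cw (cw (cw s)) = s;
  cw_neq : forall s, cw s <> s;
  glueK : involutive glue;
  glue_neq : forall s, glue s <> s;
  surf_compact : forall s, finite_set [set s' | linked cw glue s s']
}.
Arguments tri {_} _.
Arguments cw {_} _.
Arguments glue {_} _.

Inductive sign := Plus | Minus.

(* Colors are given on sides, and agree on glued sides, so that edges are
   colored. The label of a plus-triangle (resp. minus-triangle), when it has one,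
   is a plus-label (resp. minus-label). *)
Record labeled_surface := LabeledSurface {
  lsurf :> surface;
  sgn : triangle lsurf -> sign;
  col : side lsurf -> color;
  lab : triangle lsurf -> option N;
  col_glue : forall s, col (glue s) = col s
}.
Arguments sgn {_} _.
Arguments col {_} _.
Arguments lab {_} _.

(* Commuting with [cw], rather than exchanging it with its inverse, is the
   preservation of orientation. *)
Record isomorphism (S S' : labeled_surface) := Isomorphism {
  on_tri : triangle S -> triangle S';
  on_side : side S -> side S';
  on_tri_bij : bijective on_tri;
  on_side_bij : bijective on_side;
  iso_tri : forall s, tri (on_side s) = on_tri (tri s);
  iso_glue : forall s, glue (on_side s) = on_side (glue s);
  iso_cw : forall s, cw (on_side s) = on_side (cw s);
  iso_sgn : forall t, sgn (on_tri t) = sgn t;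
  iso_col : forall s, col (on_side s) = col s;
  iso_lab : forall t, lab (on_tri t) = lab t
}.

Definition comb_equivalent (S S' : labeled_surface) : Prop :=
  inhabited (isomorphism S S').

(* Plus-labels > b and minus-labels > a are forgotten. *)
Definition forget_labels (a b : nat) (S : labeled_surface) : labeled_surface :=
  @LabeledSurface S (@sgn S) (@col S)
    (fun t => if lab t is Some k then
                let bound := match sgn t with Plus => b | Minus => a end in
                if val k <= bound then Some k else None
              else None)
    (@col_glue S).

(** * The surface Xi(g) *)

Definition Xi_triangle : Type := sign * N.
Definition Xi_side : Type := Xi_triangle * color.

(* The color following [nu] clockwise in a triangle of sign [e]. *)
Definition next_color (e : sign) (nu : color) : color :=
  match e, nu with
  | Plus, Red => Yellow | Plus, Yellow => Blue | Plus, Blue => Red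
  | Minus, Red => Blue | Minus, Blue => Yellow | Minus, Yellow => Red
  end.

Definition Xi_cw (s : Xi_side) : Xi_side := (s.1, next_color s.1.1 s.2).

Definition Xi_glue (g : G) (s : Xi_side) : Xi_side :=
  let: ((e, k), nu) := s in
  match e with
  | Plus => ((Minus, gcol g nu k), nu)
  | Minus => ((Plus, sinv (gcol g nu) k), nu)
  end.

Lemma Xi_tri_surj (t : Xi_triangle) : exists s : Xi_side, s.1 = t.
Proof. by exists (t, Red). Qed.

Lemma Xi_triP (s s' : Xi_side) :
  s.1 = s'.1 <-> [\/ s' = s, s' = Xi_cw s | s' = Xi_cw (Xi_cw s)].
Proof.
case: s s' => [[e k] nu] [[e' k'] nu'] /=; split=> [[<- <-]|].
  by case: e nu nu' => [] [] [];
    (constructor 1; reflexivity) || (constructor 2; reflexivity) ||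
    (constructor 3; reflexivity).
by case=> [] [-> ->].
Qed.

Lemma Xi_cw3 (s : Xi_side) : Xi_cw (Xi_cw (Xi_cw s)) = s.
Proof. by case: s => [[[] k] []]. Qed.

Lemma Xi_cw_neq (s : Xi_side) : Xi_cw s <> s.
Proof. by case: s => [[[] k] []]. Qed.

Lemma Xi_glueK (g : G) : involutive (Xi_glue g).
Proof. by case=> [[[] k] nu] /=; rewrite ?sfunK ?sinvK. Qed.

Lemma Xi_glue_neq (g : G) (s : Xi_side) : Xi_glue g s <> s.
Proof. by case: s => [[[] k] nu]. Qed.

Lemma Xi_compact (g : G) (s : Xi_side) :
  finite_set [set s' | linked Xi_cw (Xi_glue g) s s'].
Proof.
pose supp (h : Sinf) := [set k | sfun h k <> k].
pose A : set N := s.1.2 |` \bigcup_nu supp (gcol g nu).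
have Afin : finite_set A.
  rewrite /A finite_setU; split; first exact: finite_set1.
  apply: (@sub_finite_set _ _
    (supp g.1.1 `|` (supp g.1.2 `|` supp g.2))).
    by move=> k [[] _ /=]; [left|right; left|right; right].
  by rewrite !finite_setU; do !split; exact: sfun_supp.
pose F e nu (k : N) : Xi_side := ((e, k), nu).
apply: (@sub_finite_set _ _
  ((F Plus Red @` A `|` F Plus Yellow @` A `|` F Plus Blue @` A) `|`
   (F Minus Red @` A `|` F Minus Yellow @` A `|` F Minus Blue @` A)));
  last first.
  by rewrite !finite_setU; do !split; exact: finite_image.
have memA (e : sign) (nu : color) (k : N) : A k ->
   ((F Plus Red @` A `|` F Plus Yellow @` A `|` F Plus Blue @` A) `|`
   (F Minus Red @` A `|` F Minus Yellow @` A `|` F Minus Blue @` A))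
   ((e, k), nu).
  move=> Ak; case: e nu => [] [];
  [left; left; left|left; left; right|left; right|
   right; left; left|right; left; right|right; right]; by exists k.
move=> s' /= L; have {L} : A s'.1.2.
  elim: L => [|t _|t _] //=; first by left.
  case: t => [[[] k] nu] /= Ak.
  - case: (pselect (gcol g nu k = k)) => [->//|gk].
    right; exists nu => //= E; apply: gk.
    by apply: (can_inj (@sfunK (gcol g nu))).
  - case: (pselect (sinv (gcol g nu) k = k)) => [->//|gk].
    by right; exists nu => //= E; apply: gk; rewrite -E sinvK.
by case: s' => [[e k] nu] /=; exact: memA.
Qed.

Definition Xi_surface (g : G) : surface :=
  @Surface Xi_triangle Xi_side fst Xi_cw (Xi_glue g)
    Xi_tri_surj Xi_triP Xi_cw3 Xi_cw_neq (Xi_glueK g) (@Xi_glue_neq g)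
    (Xi_compact g).

Lemma Xi_col_glue (g : G) (s : Xi_side) : (Xi_glue g s).2 = s.2.
Proof. by case: s => [[[] k] nu]. Qed.

Definition Xi (g : G) : labeled_surface :=
  @LabeledSurface (Xi_surface g) fst snd (fun t => Some t.2) (Xi_col_glue g).

(* Main.v *)
Require Import Defs.
From mathcomp Require Import all_boot.
From mathcomp Require Import boolp classical_sets functions cardinality.

(** A combinatorial equivalence of the partially labeled surfaces of g and g'
    is the same thing as a renumbering: a bijection sigma of the plus-triangles
    and a bijection tau of the minus-triangles with
    g'_nu sigma = tau g_nu for each color nu, where sigma fixes the numbers
    up to beta and tau those up to alpha
    ([comb_equivalentP]); colors and incidences leave no choice for the sides.
    If sigma and tau are finitely supported, this reads
    g' = tau g sigma^-1, that is, g' lies in the double coset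
    K[alpha] g K[beta] ([double_coset_relabelsP]).

    The point is therefore that arbitrary bijections can be replaced by finitely
    supported ones ([relabels_finite]).  Let B be a finite set that contains the
    supports of the three components of g and all numbers up to alpha or beta.
    A finitely supported permutation s can be chosen to agree with sigma on B
    ([Sinf_extend]), and tau is then replaced by t = g'_red s g_red^-1.
    Components of the surface that meet B are mapped as before.  A plus-triangle
    k outside B forms a sphere of two triangles with the minus-triangle k, and so
    does its image s k: every plus-triangle of g' that does not lie in such a
    sphere is sigma j with j in B, hence is s j with j different from k. *)

Set Implicit Arguments.
Unset Strict Implicit.
Unset Printing Implicit Defensive.

Local Open Scope classical_set_scope.
Local Open Scope group_scope.

(** * Finitely supported permutations *)

Definition swap (a b k : N) : N :=
  if k == a then b else if k == b then a else k.

Lemma swapK (a b : N) : involutive (swap a b).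
Proof.
move=> k; rewrite /swap; case: (eqVneq k a) => [->|ka].
  by case: (eqVneq b a) => [->|_]; rewrite ?eqxx.
by case: (eqVneq k b) => [->|/negPf kb]; rewrite ?eqxx // (negPf ka) kb.
Qed.

Lemma swap_supp (a b : N) : finite_set [set k | swap a b k <> k].
Proof.
apply: (@sub_finite_set _ _ [set a; b]); last exact: finite_set2.
move=> k; rewrite /= /swap; case: (eqVneq k a) => [->|_]; first by left.
by case: (eqVneq k b) => [->|_]; first by right.
Qed.

Definition transposition (a b : N) : Sinf :=
  MkSinf (swapK a b) (swapK a b) (swap_supp a b).

(** By induction on B: when a point x is added, composing with the transposition
    of h x and f x corrects the value at x, and the injectivity of f and of h
    keeps the values at the other points of B away from both. *)
Lemma Sinf_extend (f : N -> N) (B : set N) :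
  injective f -> finite_set B -> exists h : Sinf, forall k, B k -> h k = f k.
Proof.
move=> finj /finite_seqP [s ->] {B}.
elim: s => [|x s [h hP]]; first by exists (1 : Sinf).
case: (boolP (x \in s)) => [xs|xNs].
  exists h => k /=; rewrite inE => /orP [/eqP->|ks]; exact: hP.
exists ((transposition (h x) (f x) : Sinf) * h) => k /=.
rewrite inE /swap => /orP [/eqP->|ks]; first by rewrite eqxx.
have kx : k != x by apply: contraNneq xNs => <-.
rewrite ifN; last by apply: contra kx => /eqP /(can_inj (@sfunK h)) ->.
by rewrite hP // ifN //; apply: contra kx => /eqP /finj ->.
Qed.

(** * Double cosets *)

Lemma gcolP (g g' : G) : (forall nu k, gcol g nu k = gcol g' nu k) -> g = g'.
Proof.
case: g g' => [[r y] b] [[r' y'] b'] E.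
have -> : r = r' by apply: SinfP; exact: (E Red).
have -> : y = y' by apply: SinfP; exact: (E Yellow).
by have -> : b = b' by apply: SinfP; exact: (E Blue).
Qed.

Lemma K1 a : K a 1.
Proof. by exists (1 : Sinf). Qed.

Lemma KM a x y : K a x -> K a y -> K a (x * y).
Proof.
move=> [h hP <-] [h' h'P <-]; exists (h * h') => //= k ka.
by rewrite h'P ?hP.
Qed.

Lemma KV a x : K a x -> K a x^-1.
Proof.
move=> [h hP <-]; exists h^-1 => //= k ka.
by rewrite -{1}(hP k ka); exact: sfunK.
Qed.

Lemma double_coset_sub a b (g g' : G) :
  double_coset a b g g' -> double_coset a b g' `<=` double_coset a b g.
Proof.
move=> [x xK [y yK <-]] _ [u uK [v vK <-]].
exists (u * x); first exact: KM.
by exists (y * v); [exact: KM|rewrite !mulgA].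
Qed.

Lemma eq_double_coset a b (g g' : G) :
  double_coset a b g = double_coset a b g' <-> double_coset a b g g'.
Proof.
split=> [->|gg'].
  by exists 1; [exact: K1|exists 1; [exact: K1|rewrite mulg1 mul1g]].
apply/seteqP; split; last exact: double_coset_sub.
apply: double_coset_sub; case: gg' => x xK [y yK <-].
exists x^-1; first exact: KV.
by exists y^-1; [exact: KV|rewrite !mulgA mulVg mul1g mulgK].
Qed.

(** * Renumberings of the triangles *)

Definition relabels (a b : nat) (g g' : G) (sigma tau : N -> N) : Prop :=
  [/\ bijective sigma, bijective tau,
      forall nu k, gcol g' nu (sigma k) = tau (gcol g nu k),
      forall k, (val k <= b)%N -> sigma k = k &
      forall k, (val k <= a)%N -> tau k = k].

Lemma Sinf_bij (h : Sinf) : bijective h.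
Proof. by exists (sinv h); [exact: sfunK|exact: sinvK]. Qed.

Lemma double_coset_relabelsP a b (g g' : G) :
  double_coset a b g g' <-> exists s t : Sinf, relabels a b g g' s t.
Proof.
split=> [[_ [t tP <-] [_ [s sP <-] <-]]|[s [t [_ _ E sP tP]]]].
  exists s^-1, t; split; try exact: Sinf_bij; last exact: tP.
    by move=> [] k /=; rewrite sinvK.
  by move=> k kb; rewrite -{1}(sP k kb); exact: sfunK.
exists (diag t); first by exists t.
exists (diag s^-1); first by apply: (@KV b (diag s)); exists s.
apply: gcolP => nu k; transitivity (t (gcol g nu (sinv s k))).
  by case: nu.
by rewrite -E sinvK.
Qed.

Definition tri_map (sigma tau : N -> N) (t : Xi_triangle) : Xi_triangle :=
  (t.1, match t.1 with Plus => sigma | Minus => tau end t.2).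

Definition side_map (sigma tau : N -> N) (s : Xi_side) : Xi_side :=
  (tri_map sigma tau s.1, s.2).

Lemma tri_mapK (f f' h h' : N -> N) :
  cancel f f' -> cancel h h' -> cancel (tri_map f h) (tri_map f' h').
Proof. by move=> fK hK [[] k]; rewrite /tri_map /= ?fK ?hK. Qed.

Lemma side_mapK (f f' h h' : N -> N) :
  cancel f f' -> cancel h h' -> cancel (side_map f h) (side_map f' h').
Proof. by move=> fK hK [t nu]; rewrite /side_map /= (tri_mapK fK hK). Qed.

(** An injective map that fixes the numbers up to c maps no other number there, so the
    forgotten labels stay forgotten. *)
Lemma kept_label (f : N -> N) (c : nat) (k : N) :
  injective f -> (forall j, (val j <= c)%N -> f j = j) ->
  (if (val (f k) <= c)%N then Some (f k) else None) =
  (if (val k <= c)%N then Some k else None).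
Proof.
move=> finj fP; case: (leqP (val k) c) => kc; first by rewrite fP ?kc.
case: ifP => // fkc; have fk := finj _ _ (fP _ fkc).
by move: kc; rewrite -fk ltnNge fkc.
Qed.

Lemma relabels_comb_equivalent a b (g g' : G) (sigma tau : N -> N) :
  relabels a b g g' sigma tau ->
  comb_equivalent (forget_labels a b (Xi g)) (forget_labels a b (Xi g')).
Proof.
case=> [[sigma' sK sK'] [tau' tK tK'] E sP tP]; constructor.
apply: (@Isomorphism (forget_labels a b (Xi g)) (forget_labels a b (Xi g'))
  (tri_map sigma tau) (side_map sigma tau)) => //.
- by exists (tri_map sigma' tau'); exact: tri_mapK.
- by exists (side_map sigma' tau'); exact: side_mapK.
- move=> [[[] k] nu]; rewrite /side_map /tri_map /= ?E //.
  by rewrite -{1}(sinvK (gcol g nu) k) -E sfunK.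
- move=> [[] k] /=; apply: kept_label => //; exact: can_inj.
Qed.

(** Signs are preserved, so an isomorphism splits into a map of plus-triangles and
    a map of minus-triangles; a side is determined by its triangle and its color,
    so compatibility with the gluing is the equation that ties the two maps. *)
Lemma comb_equivalent_relabels a b (g g' : G) :
  comb_equivalent (forget_labels a b (Xi g)) (forget_labels a b (Xi g')) ->
  exists sigma tau, relabels a b g g' sigma tau.
Proof.
case=> [[f fs [f' fK f'K] _ /= Htri Hglue _ Hsgn Hcol Hlab]].
pose p e k := (f (e, k)).2.
have fE e k : f (e, k) = (e, p e k).
  by rewrite [LHS]surjective_pairing Hsgn.
have fsE e k nu : fs ((e, k), nu) = ((e, p e k), nu).
  by rewrite [LHS]surjective_pairing Htri Hcol fE.
have p_bij e : bijective (p e).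
  exists (fun k => (f' (e, k)).2) => k; first by rewrite -fE fK.
  have f'1 : (f' (e, k)).1 = e by rewrite -(Hsgn (f' (e, k))) f'K.
  have f'E : f' (e, k) = (e, (f' (e, k)).2).
    by rewrite [LHS]surjective_pairing f'1.
  by rewrite /p -f'E f'K.
exists (p Plus), (p Minus); split => //.
- by move=> nu k; have := Hglue ((Plus, k), nu); rewrite !fsE /= => -[].
- move=> k kb; have := Hlab (Plus, k); rewrite fE /= kb.
  by case: ifP => // _ [].
- move=> k kb; have := Hlab (Minus, k); rewrite fE /= kb.
  by case: ifP => // _ [].
Qed.

Lemma comb_equivalentP a b (g g' : G) :
  comb_equivalent (forget_labels a b (Xi g)) (forget_labels a b (Xi g')) <->
  exists sigma tau, relabels a b g g' sigma tau.
Proof.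
split; first exact: comb_equivalent_relabels.
by case=> sigma [tau]; exact: relabels_comb_equivalent.
Qed.

(** * Making a renumbering finitely supported *)

Lemma finite_val_le (c : nat) : finite_set [set k : N | (val k <= c)%N].
Proof.
apply: (@sub_finite_set _ _ ((fun n => insubd (exist _ 1%N isT : N) n) @` `I_c.+1)).
  by move=> k kc; exists (val k) => //; exact: valKd.
by apply: finite_image; exact: finite_II.
Qed.

Lemma finite_core a b (g : G) :
  exists2 B : set N, finite_set B &
    (forall nu k, ~ B k -> gcol g nu k = k) /\
    (forall k, (val k <= maxn a b)%N -> B k).
Proof.
exists ([set k | gcol g Red k <> k] `|` [set k | gcol g Yellow k <> k] `|`
        [set k | gcol g Blue k <> k] `|` [set k | (val k <= maxn a b)%N]).
  by rewrite !finite_setU; do !split; try exact: sfun_supp; exact: finite_val_le.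
split=> [nu k kB|k kab]; last by right.
apply: contrapT => gk; apply: kB.
by left; case: nu gk; [left; left|left; right|right].
Qed.

Lemma sfun_stable (h : Sinf) (B : set N) (k : N) :
  (forall j, ~ B j -> h j = j) -> B (h k) <-> B k.
Proof.
move=> hB; split=> Bk; apply: contrapT => nB; apply: (nB).
  by rewrite -(hB k nB).
by have /(can_inj (@sfunK h)) -> := hB _ nB.
Qed.

Lemma relabels_finite a b (g g' : G) (sigma tau : N -> N) :
  relabels a b g g' sigma tau -> exists s t : Sinf, relabels a b g g' s t.
Proof.
case=> [[sigma' sK sK'] _ E sP tP].
have [B Bfin [Bfix Ble]] := finite_core a b g.
have [s sB] := Sinf_extend (can_inj sK) Bfin.
(* The only possible partner of s, read off from the red gluings. *)
pose t : Sinf := (gcol g' Red : Sinf) * s * (gcol g Red)^-1.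
have tE l : t l = gcol g' Red (s (sinv (gcol g Red) l)) by [].
have stable nu k : B (gcol g nu k) <-> B k := sfun_stable k (Bfix nu).
have t_core l : B l -> t l = tau l.
  move=> Bl; have Bk : B (sinv (gcol g Red) l).
    by apply/(stable Red); rewrite sinvK.
  by rewrite tE sB // E sinvK.
exists s, t; split; try exact: Sinf_bij.
- move=> nu k; case: (pselect (B k)) => [Bk|nBk].
    by rewrite t_core ?sB ?E //; apply/stable.
  rewrite Bfix // tE.
  have -> : sinv (gcol g Red) k = k by rewrite -{1}(Bfix Red k nBk) sfunK.
  (* s k is sigma j for some j; such a j cannot lie in B, where s and sigma agree. *)
  have nBj : ~ B (sigma' (s k)).
    move=> Bj; have := sB _ Bj; rewrite sK' => /(can_inj (@sfunK s)) jk.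
    by rewrite jk in Bj.
  by rewrite -(sK' (s k)) !E !Bfix.
- by move=> k kb; rewrite sB ?sP //; apply: Ble; rewrite leq_max kb orbT.
- by move=> k ka; rewrite t_core ?tP //; apply: Ble; rewrite leq_max ka.
Qed.

Theorem theorem3p4 (alpha beta : nat) (g g' : G) :
  double_coset alpha beta g = double_coset alpha beta g' <->
  comb_equivalent (forget_labels alpha beta (Xi g))
                  (forget_labels alpha beta (Xi g')).
Proof.
rewrite eq_double_coset double_coset_relabelsP comb_equivalentP.
split=> [[s [t st]]|[sigma [tau]]]; first by exists s, t.
exact: relabels_finite.
Qed.
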